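(* Let $\Lambda \subset \mathbb{R}^n$ be a lattice which is symmetric with respect to all coordinate axes, i.e., for every $(x_1,\dots,x_n)\in\Lambda$ and every $i\in\{1,\dots,n\}$ one has $(x_1,\dots,x_{i-1},-x_i,x_{i+1},\dots,x_n)\in\Lambda$. Let $\mathcal{C}\subseteq\mathbb{F}_2^n$ be a linear binary code. Then $\Gamma=\Lambda+\mathcal{C}=\{\lambda+c:\lambda\in\Lambda,\ c\in\mathcal{C}\}\subset\mathbb{R}^n$ is geometrically uniform.
   Context: A lattice in $\mathbb{R}^n$ is the set of all integer linear combinations of $n$ linearly independent vectors of $\mathbb{R}^n$ (only full rank lattices are considered). A linear binary code is a linear subspace of $\mathbb{F}_2^n$; its codewords are regarded as vectors in $\{0,1\}^n\subset\mathbb{R}^n$ via the natural embedding, and the sum $\lambda+c$ is the real sum. A constellation (discrete set of points) $\Gamma\subset\mathbb{R}^n$ is geometrically uniform if for any two elements $c,c'\in\Gamma$ there exists a distance-preserving transformation $T:\mathbb{R}^n\to\mathbb{R}^n$ such that $c'=T(c)$ and $T(\Gamma)=\Gamma$. *)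

(* Defs.v *)
From mathcomp Require Import all_boot all_order all_algebra.
From mathcomp Require Import all_classical all_reals all_analysis.

Set Implicit Arguments.
Unset Strict Implicit.
Unset Printing Implicit Defensive.

Import Order.TTheory GRing.Theory Num.Theory.
Import numFieldNormedType.Exports.

Local Open Scope classical_set_scope.
Local Open Scope ring_scope.

Definition is_lattice (R : realType) (n : nat) (L : set 'rV[R]_n) : Prop :=
  exists b : n.-tuple 'rV[R]_n,
    free b /\ L = [set \sum_(i < n) b`_i *~ z i | z in [set: 'I_n -> int]].

Definition reflect_coord (R : realType) (n : nat) (i : 'I_n) (x : 'rV[R]_n) :
    'rV[R]_n :=
  \row_j (if j == i then - x 0 j else x 0 j).

Definition coord_symmetric (R : realType) (n : nat) (L : set 'rV[R]_n) : Prop :=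
  forall (x : 'rV[R]_n) (i : 'I_n), L x -> L (reflect_coord i x).

(* The inner coercion ['F_2 >-> nat] is the representative in {0, 1}. *)
Definition code_embed (R : realType) (n : nat) (c : 'rV['F_2]_n) : 'rV[R]_n :=
  \row_j (c 0 j : nat)%:R.

Definition lattice_plus_code (R : realType) (n : nat) (L : set 'rV[R]_n)
    (C : {vspace 'rV['F_2]_n}) : set 'rV[R]_n :=
  [set l + code_embed R c | l in L & c in [set` C]].

(* The library norm on ['rV[R]_n] is the sup norm, so the Euclidean distance is
   written out. *)
Definition edist (R : realType) (n : nat) (x y : 'rV[R]_n) : R :=
  Num.sqrt (\sum_(i < n) (x 0 i - y 0 i) ^+ 2).

Definition distance_preserving (R : realType) (n : nat)
    (T : 'rV[R]_n -> 'rV[R]_n) : Prop :=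
  forall x y : 'rV[R]_n, edist (T x) (T y) = edist x y.

(* A discrete set of points: every point is isolated.  The topology of
   ['rV[R]_n] is induced by the sup norm, hence is the Euclidean one. *)
Definition constellation (R : realType) (n : nat) (G : set 'rV[R]_n) : Prop :=
  G `<=` isolated G.

(* The notion only makes sense for constellations, hence the first conjunct. *)
Definition geometrically_uniform (R : realType) (n : nat)
    (G : set 'rV[R]_n) : Prop :=
  constellation G /\
  forall c c' : 'rV[R]_n, G c -> G c' ->
    exists T : 'rV[R]_n -> 'rV[R]_n,
      [/\ distance_preserving T, c' = T c & T @` G = G].

(* Main.v *)
(** The lattice is stable under every reflection in coordinate hyperplanes. For
    binary words [c] and [d], changing the sign of the coordinates in the
    support of [d] and adding [d] as a real vector sends [c] to the mod 2 sum of
    [c] and [d]. Hence, given [l + c] and [l' + c'], reflecting about [l + c] in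
    the support of [c + c'] and then moving [l + c] to [l' + c'] preserves
    [L + C]; the inverse isometry has the same shape. Discreteness holds because
    [L + C] is a finite union of translates of [L], and each of these is
    discrete and closed, like the integers. *)
Require Import Defs.
From mathcomp Require Import all_boot all_order all_algebra.
From mathcomp Require Import all_classical all_reals all_analysis.

Set Implicit Arguments.
Unset Strict Implicit.
Unset Printing Implicit Defensive.

Import Order.TTheory GRing.Theory Num.Theory.
Import numFieldNormedType.Exports.

Local Open Scope classical_set_scope.
Local Open Scope ring_scope.

(** Discreteness and closedness of the integers at once: [t] may or may not be an integer. If it is,
    the open interval from [t - 1] to [t + 1] contains no other; if not, the one from [f] to [f + 1]
    contains none. *)
Lemma near_intr_eq (R : realType) (t : R) :
  \forall s \near t, forall z : int, s = z%:~R -> s = t.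
Proof.
have /andP[ft tf] := floor_itv t; set f := Num.floor t in ft tf *.
case: (eqVneq f%:~R t) => [ftE|ftN].
  have tf' : (f - 1)%:~R < t by rewrite -ftE ltr_int ltrBlDr ltrDl.
  near=> s => z sE; rewrite sE -ftE; congr _%:~R.
  have /= fz : (f - 1)%:~R < s by near: s; exact: lt_nbhsr.
  have /= zf : s < (f + 1)%:~R by near: s; exact: lt_nbhsl.
  move: fz zf; rewrite sE !ltr_int ltzD1 ltrBlDr ltzD1 => fz zf.
  by apply/eqP; rewrite eq_le fz zf.
have {ftN} ft : f%:~R < t by rewrite lt_neqAle ftN.
near=> s => z sE; exfalso.
have /= fz : f%:~R < s by near: s; exact: lt_nbhsr.
have /= zf : s < (f + 1)%:~R by near: s; exact: lt_nbhsl.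
by move: fz zf; rewrite sE !ltr_int ltzD1 => fz /(lt_le_trans fz); rewrite ltxx.
Unshelve. all: by end_near. Qed.

Lemma linear_rV_continuous (R : realType) (n : nat)
    (f : {linear 'rV[R]_n -> R^o}) : continuous (f : 'rV[R]_n -> R).
Proof.
have -> : (f : 'rV[R]_n -> R) =
    fun x => \sum_(i < n) x 0 i * f (delta_mx 0 i).
  apply/funext => x; rewrite {1}(row_sum_delta x) linear_sum.
  by apply: eq_bigr => i _; rewrite linearZ.
apply: (continuous_big (@add_continuous R^o)) => i _ x.
exact: cvgM (@coord_continuous R 1 n 0 i x) (cvg_cst _).
Qed.

Section lattice.
Context (R : realType) (n : nat) (L : set 'rV[R]_n).
Hypothesis latL : is_lattice L.

(** In the lattice basis, the coordinates of a point of [L] are integers, so [near_intr_eq] applies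
    to each coordinate of [y - a]. As [p] is arbitrary, the translate of [L] by [a] is both discrete
    and closed. *)
Lemma lattice_translate_near_eq (a p : 'rV[R]_n) :
  \forall y \near p, L (y - a) -> y = p.
Proof.
have [b [b_free ->]] := latL.
have b_basis : basis_of {:'rV[R]_n} b.
  by rewrite basisEfree b_free subvf dimvf size_tuple /dim /= mul1n.
have : \forall y \near p, forall (j : 'I_n) (z : int),
    coord b j y - coord b j a = z%:~R ->
    coord b j y - coord b j a = coord b j p - coord b j a.
  apply: (@filter_forall _ _ _ (nbhs p) (nbhs_filter p)) => j.
  have cont_j := @linear_rV_continuous R n (coord b j) p.
  exact: (cvgB cont_j (cvg_cst _)) (near_intr_eq _).
apply: filterS => y yp [z _ yE].
rewrite (coord_basis b_basis (memvf y)) (coord_basis b_basis (memvf p)).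
apply: eq_bigr => j _; congr (_ *: _).
apply: (addIr (- coord b j a)); apply: (yp j (z j)).
rewrite -linearB /= -yE -[RHS](@coord_sum_free _ _ _ b (fun i => (z i)%:~R)) //.
by congr (coord _ _ _); apply: eq_bigr => i _; rewrite scaler_int.
Qed.

Lemma latticeD x y : L x -> L y -> L (x + y).
Proof.
have [b [_ ->]] := latL => -[z _ <-] [w _ <-].
exists (fun i => z i + w i) => //.
by rewrite -big_split; apply: eq_bigr => i _; rewrite mulrzDr.
Qed.

Lemma latticeN x : L x -> L (- x).
Proof.
have [b [_ ->]] := latL => -[z _ <-].
exists (fun i => - z i) => //.
by rewrite -sumrN; apply: eq_bigr => i _; rewrite mulrNz.
Qed.

End lattice.

Lemma lattice_plus_code_constellation (R : realType) (n : nat)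
    (L : set 'rV[R]_n) (C : {vspace 'rV['F_2]_n}) :
  is_lattice L -> constellation (lattice_plus_code L C).
Proof.
move=> latL x Gx; split; first exact: mem_set.
(* Binary words form a finite type, so [V] is a finite intersection of neighbourhoods of [x], one
   for each translate of [L]. *)
pose V := [set y | forall c : 'rV['F_2]_n, L (y - code_embed R c) -> y = x].
exists V.
  apply: (@filter_forall _ _ _ (nbhs x) (nbhs_filter x)) => c.
  exact: lattice_translate_near_eq.
apply/seteqP; split => [y [Vy [l Ll [c _ yE]]]|y -> //].
by apply: (Vy c); rewrite -yE addrK.
Qed.

Definition flip (R : realType) (n : nat) (P : pred 'I_n) (x : 'rV[R]_n) :
    'rV[R]_n :=
  \row_j (if P j then - x 0 j else x 0 j).

Lemma flip_stable (R : realType) (n : nat) (L : set 'rV[R]_n) (P : pred 'I_n)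
    (x : 'rV[R]_n) :
  coord_symmetric L -> L x -> L (flip P x).
Proof.
move=> symL Lx.
have -> : flip P x = flip (mem (enum P)) x.
  by apply/rowP => j; rewrite !mxE /= mem_enum.
(* The flip is a product of coordinate reflections. Uniqueness matters: reflecting twice in the same
   coordinate would undo the sign change. *)
elim: (enum P) (enum_uniq P) => [_|i s IHs /= /andP[iNs /IHs Ls]].
  by have -> : flip (mem [::]) x = x by apply/rowP => j; rewrite !mxE.
have -> : flip (mem (i :: s)) x = reflect_coord i (flip (mem s) x).
  apply/rowP => j; rewrite !mxE /= inE.
  by case: eqVneq => [->|//]; rewrite (negPf iNs).
exact: symL.
Qed.

Lemma flipD (R : realType) (n : nat) (P : pred 'I_n) (x y : 'rV[R]_n) :
  flip P (x + y) = flip P x + flip P y.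
Proof. by apply/rowP => j; rewrite !mxE; case: (P j); rewrite ?opprD. Qed.

Lemma flipB (R : realType) (n : nat) (P : pred 'I_n) (x y : 'rV[R]_n) :
  flip P (x - y) = flip P x - flip P y.
Proof. by apply/rowP => j; rewrite !mxE; case: (P j); rewrite ?opprD. Qed.

Lemma flipK (R : realType) (n : nat) (P : pred 'I_n) :
  involutive (@flip R n P).
Proof.
by move=> x; apply/rowP => j; rewrite !mxE; case: (P j); rewrite ?opprK.
Qed.

Definition supp (n : nat) (c : 'rV['F_2]_n) : pred 'I_n := fun j => c 0 j != 0.

Lemma F2_cases (a : 'F_2) : a = 0 \/ a = 1.
Proof. by case: a => -[|[|//]] i; [left | right]; exact: val_inj. Qed.

(** Where [c] and [c'] agree, the left side is the coordinate of [x]. Where they differ, their real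
    coordinates add up to 1, and it is 1 minus that coordinate, which is the mod 2 sum with 1. *)
Lemma code_embed_flip (R : realType) (n : nat) (c c' x : 'rV['F_2]_n) :
  code_embed R c' + flip (supp (c + c')) (code_embed R x - code_embed R c)
  = code_embed R (x + (c + c')).
Proof.
apply/rowP => j; rewrite !mxE /supp !mxE.
case: (F2_cases (c 0 j)) => ->; case: (F2_cases (c' 0 j)) => ->;
  by case: (F2_cases (x 0 j)) => -> /=;
    rewrite ?(subr0, sub0r, subrr, oppr0, addr0, add0r, opprK).
Qed.

(** The affine isometry with linear part [flip P] that takes [g] to [g']; exchanging [g] and [g']
    inverts it. *)
Definition transport (R : realType) (n : nat) (P : pred 'I_n)
    (g g' x : 'rV[R]_n) : 'rV[R]_n :=
  g' + flip P (x - g).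

Lemma transportK (R : realType) (n : nat) (P : pred 'I_n) (g g' : 'rV[R]_n) :
  cancel (transport P g g') (transport P g' g).
Proof. by move=> x; rewrite /transport addrAC subrr add0r flipK addrC subrK. Qed.

Lemma transport_distance_preserving (R : realType) (n : nat) (P : pred 'I_n)
    (g g' : 'rV[R]_n) : distance_preserving (transport P g g').
Proof.
move=> x y; congr Num.sqrt; apply: eq_bigr => i _.
have -> (a b : 'rV[R]_n) : a 0 i - b 0 i = (a - b) 0 i by rewrite !mxE.
rewrite /transport opprD addrACA subrr add0r -flipB opprB addrA subrK !mxE.
by case: ifP => _ //; rewrite sqrrN.
Qed.

Lemma transport_stable (R : realType) (n : nat) (L : set 'rV[R]_n)
    (C : {vspace 'rV['F_2]_n}) (l l' : 'rV[R]_n) (c c' : 'rV['F_2]_n) :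
  is_lattice L -> coord_symmetric L -> L l -> L l' -> c \in C -> c' \in C ->
  transport (supp (c + c')) (l + code_embed R c) (l' + code_embed R c')
    @` lattice_plus_code L C `<=` lattice_plus_code L C.
Proof.
move=> latL symL Ll Ll' Cc Cc' _ [_ [m Lm [x Cx <-]] <-].
(* By additivity of [flip], the image of [m + code_embed R x] splits into this lattice part and a
   code part, which [code_embed_flip] evaluates. *)
exists (l' + flip (supp (c + c')) (m - l)).
  apply: latticeD => //; apply: flip_stable => //.
  by apply: latticeD => //; exact: latticeN.
exists (x + (c + c')); first by rewrite /= !memvD.
by rewrite -code_embed_flip addrACA -flipD /transport opprD [m + _ + _]addrACA.
Qed.

Theorem theorem2 (R : realType) (n : nat) (L : set 'rV[R]_n)
    (C : {vspace 'rV['F_2]_n}) :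
  is_lattice L -> coord_symmetric L ->
  geometrically_uniform (lattice_plus_code L C).
Proof.
move=> latL symL; split; first exact: lattice_plus_code_constellation.
move=> _ _ [l Ll [c Cc <-]] [l' Ll' [c' Cc' <-]].
exists (transport (supp (c + c')) (l + code_embed R c) (l' + code_embed R c')).
split; first exact: transport_distance_preserving.
  by rewrite /transport subrr -[0](subrr 0) flipB subrr addr0.
apply/seteqP; split; first exact: transport_stable.
(* The preimage of [y] is its image under the inverse isometry, which stays in the constellation by
   the same stability with the two points exchanged. *)
move=> y Gy; rewrite -(transportK (supp (c + c')) (l' + code_embed R c')
  (l + code_embed R c) y).
apply: imageP; apply: (transport_stable latL symL Ll' Ll Cc' Cc).
by rewrite [c' + c]addrC; exact: imageP.
Qed.
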